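(* Let $m$ and $n$ be relatively prime positive integers with $3\le m<n$, and define $$\phi=\Bigl(T_m,\;T_n,\;\frac{d}{dt}\,\frac{U_{mn-1}}{U_{m-1}U_{n-1}}\Bigr).$$ Then $\phi:\mathbb{R}^1\to\mathbb{R}^3$ is an embedding, and $\phi(\mathbb{R}^1)$ is the alternating $(m,n)$-knot.
   Context: The ground field is $\mathbb{R}$. $T_n$ and $U_n$ denote the Chebyshev polynomials of the first and second kind: $T_0=1$, $T_1=t$, $T_{n+1}=2tT_n-T_{n-1}$ $(n\ge1)$; $U_{-1}=0$, $U_0=1$, $U_{n+1}=2tU_n-U_{n-1}$ $(n\ge0)$. When $\gcd(m,n)=1$ the quotient $U_{mn-1}/(U_{m-1}U_{n-1})$ is a polynomial in $t$. An embedding $\mathbb{R}^1\to\mathbb{R}^3$ here means an algebraic embedding of the affine line over $\mathbb{R}$: a polynomial map $(f_1,f_2,f_3)$ with $\mathbb{R}[f_1,f_2,f_3]=\mathbb{R}[t]$. Embedded lines in $\mathbb{R}^3$ are regarded as knots (adding the point at infinity gives a knot in $S^3$), considered up to topological equivalence: there is a homeomorphism of $\mathbb{R}^3$ to itself carrying one embedded line to the other (so mirror images are not distinguished). A nodal curve $C\subset\mathbb{A}^2$ is a curve admitting a parametrization $\alpha:\mathbb{A}^1\to\mathbb{A}^2$ such that $\alpha'$ is non-vanishing and every singularity of $C$ is a node. Let $S$ be its set of nodes, $|S|=N$, and $\alpha^{-1}(S)=\{t_1<t_2<\cdots<t_{2N}\}$. A crossing sequence for $C$ is a sequence $a_1,\dots,a_{2N}$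 of elements of $\{-1,1\}$ such that $a_pa_q=-1$ whenever $\alpha(t_p)=\alpha(t_q)$, $p\neq q$. A nodal curve together with a crossing sequence determines a knot, unique up to knot type: the crossing sequence encodes the over- and under-crossing data of a knot having $C$ as regular projection, i.e. a knot $t\mapsto(\alpha(t),h(t))$ such that, at each node $\alpha(t_p)=\alpha(t_q)$ with $a_p=1$, $a_q=-1$, one has $h(t_p)>h(t_q)$. The sequence $a_s=(-1)^s$, $1\le s\le 2N$, is a crossing sequence for any nodal curve, called the alternating crossing sequence. For relatively prime positive integers $m<n$, the curve parametrized by $(T_m,T_n)$ is a nodal curve with $\frac12(m-1)(n-1)$ nodes; the alternating $(m,n)$-knot is the knot determined by the alternating crossing sequence for this curve. *)

(* Defs.v *)
From HB Require Import structures.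
From mathcomp Require Import all_boot all_order all_algebra.
From mathcomp.multinomials Require mpoly.
From mathcomp Require Import boolp classical_sets reals topology normedtype.

Set Implicit Arguments.
Unset Strict Implicit.
Unset Printing Implicit Defensive.

Import Order.TTheory GRing.Theory Num.Theory.
Import numFieldNormedType.Exports.
Local Open Scope classical_set_scope.
Local Open Scope ring_scope.

Fixpoint chebT (R : nzRingType) (n : nat) : {poly R} :=
  match n with
  | 0 => 1
  | n1.+1 => if n1 is n2.+1 then 2%:R *: 'X * chebT R n1 - chebT R n2 else 'X
  end.

(* U_(-1) = 0 has no index in [nat]; it enters as U_1 = 2t U_0 - U_(-1) = 2t. *)
Fixpoint chebU (R : nzRingType) (n : nat) : {poly R} :=
  match n with
  | 0 => 1
  | n1.+1 =>
    if n1 is n2.+1 then 2%:R *: 'X * chebU R n1 - chebU R n2 else 2%:R *: 'X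
  end.

Section PolynomialMaps.
Variables (R : realType) (n : nat).

(* A tuple of n polynomials stands for a polynomial map R^1 -> R^n. *)
Definition polymap (f : n.-tuple {poly R}) (t : R) : 'rV[R]_n :=
  \row_i (tnth f i).[t].

Definition velocity (f : n.-tuple {poly R}) (t : R) : 'rV[R]_n :=
  \row_i ((tnth f i)^`()).[t].

(* R[f_1, ..., f_n] = R[t], where mmap substitutes f_1, ..., f_n in P *)
Definition is_embedding (f : n.-tuple {poly R}) : Prop :=
  forall p : {poly R}, exists P : mpoly.mpoly n R,
    mpoly.mmap (@polyC R) (tnth f) P = p.

End PolynomialMaps.

Definition knot_equiv (R : realType) (K L : set 'rV[R]_3) : Prop :=
  exists F G : 'rV[R]_3 -> 'rV[R]_3,
    [/\ continuous F, continuous G, cancel F G, cancel G F & F @` K = L].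

Section NodalCurves.
Variable R : realType.
Implicit Types (alpha : 2.-tuple {poly R}) (s : seq R) (a : seq int).

(* For alpha with non-vanishing velocity, the singular points of the curve
   alpha(R) are exactly the points with at least two parameters. *)
Definition singular_points alpha : set 'rV[R]_2 :=
  [set P | exists t u, [/\ t <> u, polymap alpha t = P & polymap alpha u = P]].

(* ordinary double points: two branches with independent tangents *)
Definition nodes alpha : set 'rV[R]_2 :=
  [set P | exists t u, [/\ t <> u, polymap alpha @^-1` [set P] = [set t; u] &
     row_free (col_mx (velocity alpha t) (velocity alpha u))]].

Definition nodal alpha : Prop :=
  (forall t, velocity alpha t <> 0) /\ singular_points alpha `<=` nodes alpha.

(* s = [:: t_1; ...; t_2N] lists alpha^-1(S) increasingly, S the set of nodes;
   sequences are indexed from 0, so t_i is [nth 0 s i.-1]. *)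
Definition node_params alpha s : Prop :=
  sorted <%R s /\ [set` s] = polymap alpha @^-1` nodes alpha.

Definition crossing_sequence alpha s a : Prop :=
  [/\ size a = size s, {subset a <= [:: -1; 1]} &
    forall p q, (p < size s)%N -> (q < size s)%N -> p <> q ->
      polymap alpha s`_p = polymap alpha s`_q -> a`_p * a`_q = -1].

(* a_i = (-1)^i for i = 1, ..., k *)
Definition alternating (k : nat) : seq int := mkseq (fun i => (-1) ^+ i.+1) k.

(* The embedded line t |-> (alpha t, h t) has the crossings prescribed by a. *)
Definition realizes alpha s a (h : {poly R}) : Prop :=
  is_embedding [tuple of rcons alpha h] /\
  forall p q, (p < size s)%N -> (q < size s)%N ->
    polymap alpha s`_p = polymap alpha s`_q -> a`_p = 1 -> a`_q = -1 ->
    h.[s`_q] < h.[s`_p].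

(* The crossing sequence determines a knot only up to knot type, so K is that
   knot when it is equivalent to a line realizing the crossing data. *)
Definition is_knot_of alpha s a (K : set 'rV[R]_3) : Prop :=
  [/\ nodal alpha, node_params alpha s, crossing_sequence alpha s a &
    exists2 h, realizes alpha s a h &
      knot_equiv K (range (polymap [tuple of rcons alpha h]))].

Definition is_alternating_knot (m n : nat) (K : set 'rV[R]_3) : Prop :=
  let alpha := [tuple chebT R m; chebT R n] in
  exists s, is_knot_of alpha s (alternating (size s)) K.

End NodalCurves.

(* Main.v *)
Require Import Defs.
From mathcomp Require Import all_boot all_order all_algebra.
From mathcomp Require Import boolp classical_sets reals topology normedtype.
From mathcomp Require Import trigo ring lra zify.
From mathcomp.multinomials Require mpoly.

(** Write [V n] for [U_(n-1)], take [u m - v n = 1] and put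
[K = T_(um + vn)], [W = (t^2 - 1) V_(mn)].  Composition with [K] swaps the
two parameters of every node, and every subalgebra containing [T_m] and [T_n]
contains all [p + p o K] (because [T_j + T_j o K = 2 T_(jum) T_(jvn)]) and the
ideal [(W)].  Applied to the algebra of polynomials agreeing at [t] and [w],
this identifies the nodes: [w = K t], and the parameters are the roots of
[Q = V_(mn) / (V_m V_n)].  With [D = (t^2 - 1) V_m V_n], which changes sign
under [K], one has [D Q' = mn T_(mn)] at these roots.  Hence [Q'] takes opposite
values at the two parameters of a node, and alternates in sign along the line
since [Q] has simple real roots.  For the embedding, modulo [(W)] every [p] is
[(p + p o K)/2 + a Q'] with [a] a multiple of the symmetric
[(p - p o K) D T_(mn)]. *)

Set Implicit Arguments.
Unset Strict Implicit.
Unset Printing Implicit Defensive.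

Import Order.TTheory GRing.Theory Num.Theory.
Local Open Scope classical_set_scope.
Local Open Scope ring_scope.

(** * Chebyshev identities as trigonometric addition formulas *)

Section ChebyshevIdentities.
Variable R : comNzRingType.
Implicit Types a b c k : nat.

(* chebV n is U_(n-1), including U_(-1) = 0. *)
Definition chebV n : {poly R} := if n is k.+1 then chebU R k else 0.

Local Notation T := (chebT R).
Local Notation V := chebV.

Lemma chebTSS n : T n.+2 = 2%:R * 'X * T n.+1 - T n.
Proof.
by rewrite -[2%:R](rmorph_nat (@polyC R)) mul_polyC.
Qed.

Lemma chebVSS n : V n.+2 = 2%:R * 'X * V n.+1 - V n.
Proof.
rewrite -[2%:R](rmorph_nat (@polyC R)) mul_polyC.
by case: n => [|n] //; rewrite /= mulr1 subr0.
Qed.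

(** At [t = cos x], [T n] is [cos (n x)] and [V n] is [sin (n x) / sin x], with [t^2 - 1] standing
    for [- sin^2 x]: this is the addition formula for the angles [n x] and [x]. *)
Lemma chebTVS n :
  T n.+1 = 'X * T n + ('X^2 - 1) * V n /\ V n.+1 = 'X * V n + T n.
Proof.
elim: n => [|n [IHT IHV]]; first by rewrite /= !mulr0 !addr0 mulr1 add0r.
by rewrite chebTSS chebVSS IHT IHV; split; ring.
Qed.

Lemma chebTV_add a b :
  T (a + b) = T a * T b + ('X^2 - 1) * (V a * V b) /\
  V (a + b) = V a * T b + T a * V b.
Proof.
elim: a => [|a [IHT IHV]]; first by rewrite add0n /=; split; ring.
by rewrite addSn; have [-> ->] := chebTVS (a + b);
  have [-> ->] := chebTVS a; rewrite IHT IHV; split; ring.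
Qed.

Lemma chebT_add a b : T (a + b) = T a * T b + ('X^2 - 1) * (V a * V b).
Proof. by case: (chebTV_add a b). Qed.

Lemma chebV_add a b : V (a + b) = V a * T b + T a * V b.
Proof. by case: (chebTV_add a b). Qed.

Lemma cheb_pell n : T n ^+ 2 = 1 + ('X^2 - 1) * V n ^+ 2.
Proof.
elim: n => [|n IH]; first by rewrite /=; ring.
have [-> ->] := chebTVS n.
transitivity (T n ^+ 2 + 2%:R * 'X * T n * V n * ('X^2 - 1) +
  ('X^2 - 1) * (T n ^+ 2) + ('X^2 - 1) ^+ 2 * V n ^+ 2); first by ring.
by rewrite IH; ring: IH.
Qed.

Lemma chebT_sub a b : (b <= a)%N ->
  T (a - b) = T a * T b - ('X^2 - 1) * (V a * V b).
Proof.
move=> /subnK; move: (a - b)%N => c <-; rewrite chebT_add chebV_add.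
by ring: (cheb_pell b).
Qed.

Lemma chebV_sub a b : (b <= a)%N -> V (a - b) = V a * T b - T a * V b.
Proof.
move=> /subnK; move: (a - b)%N => c <-; rewrite chebT_add chebV_add.
by ring: (cheb_pell b).
Qed.

Lemma chebTV_mul a b :
  T (a * b) = T a \Po T b /\ V (a * b) = (V a \Po T b) * V b.
Proof.
elim: a => [|a [IHT IHV]]; first by rewrite /= comp_poly0 mul0r comp_polyC.
rewrite mulSn chebT_add chebV_add IHT IHV.
have [-> ->] := chebTVS a.
rewrite !comp_polyD !comp_polyM comp_polyX comp_polyB comp_Xn_poly.
rewrite rmorph1; split; last by ring.
by rewrite cheb_pell; ring.
Qed.

Lemma chebT_mul a b : T (a * b) = T a \Po T b.
Proof. by case: (chebTV_mul a b). Qed.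

Lemma chebV_mul a b : V (a * b) = (V a \Po T b) * V b.
Proof. by case: (chebTV_mul a b). Qed.

Lemma cheb_deriv n :
  (T n)^`() = n%:R * V n /\ ('X^2 - 1) * (V n)^`() = n%:R * T n - 'X * V n.
Proof.
elim: n => [|n [IHT IHV]]; first by rewrite /= !derivC; split; ring.
have [-> ->] := chebTVS n.
rewrite !(derivD, derivM, derivN, derivX, derivXn, derivC) IHT /= expr1.
have {}IHV : 'X ^+ 2 * (V n)^`() = (V n)^`() + (n%:R * T n - 'X * V n).
  by rewrite -IHV; ring.
by rewrite -natr1; split; ring: IHV.
Qed.

Lemma chebT_deriv n : (T n)^`() = n%:R * V n.
Proof. by case: (cheb_deriv n). Qed.

Lemma chebV_deriv n : ('X^2 - 1) * (V n)^`() = n%:R * T n - 'X * V n.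
Proof. by case: (cheb_deriv n). Qed.

End ChebyshevIdentities.

(** * Indices of [T] at the roots of [(t^2 - 1) V N]: periodicity and reflection *)

Section ChebyshevValues.
Variable R : comNzRingType.
Implicit Types (t : R) (a b c k N : nat).

Local Notation T := (chebT R).
Local Notation V := (chebV R).

Lemma chebT_at1 n : (T n).[1] = 1.
Proof.
elim: n => [|n IH]; first by rewrite hornerE.
by rewrite (chebTVS R n).1 !hornerE IH; ring.
Qed.

(** Over the reals such a [t] is [cos (k pi / N)], and [2 N b] times its angle is a multiple of
    [2 pi]. Hence indices of [T] matter there only modulo [2 N] and up to sign. *)
Lemma chebT_double_root N b t : (t ^+ 2 - 1) * (V N).[t] = 0 ->
  (T (2 * N * b)).[t] = 1 /\ (t ^+ 2 - 1) * (V (2 * N * b)).[t] = 0.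
Proof.
move=> tN; have VN k : (t ^+ 2 - 1) * (V (k * N)).[t] = 0.
  by rewrite chebV_mul hornerM mulrCA tN mulr0.
split; last by rewrite mulnAC; exact: VN.
have T2 : (T (2 * N)).[t] = 1.
  rewrite mul2n -addnn chebT_add -expr2 cheb_pell !hornerE.
  by rewrite /= tN !mul0r !addr0.
by rewrite mulnC chebT_mul horner_comp T2 chebT_at1.
Qed.

Lemma chebT_period N b c t : (t ^+ 2 - 1) * (V N).[t] = 0 ->
  (T (2 * N * b + c)).[t] = (T c).[t].
Proof.
move=> /(chebT_double_root b) [T1 V0].
by rewrite chebT_add !hornerE T1 /= V0 mul0r addr0 mul1r.
Qed.

Lemma chebT_reflect N b c t : (t ^+ 2 - 1) * (V N).[t] = 0 ->
  (c <= 2 * N * b)%N -> (T (2 * N * b - c)).[t] = (T c).[t].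
Proof.
move=> /(chebT_double_root b) [T1 V0] le_c.
by rewrite chebT_sub // !hornerE T1 /= V0 mul0r subr0 mul1r.
Qed.

End ChebyshevValues.

(** * Subalgebras of polynomials and Chebyshev spanning sets *)

Section Subalgebras.
Variable R : numFieldType.
Implicit Types (p q : {poly R}) (S L : {poly R} -> Prop).

Local Notation T := (chebT R).
Local Notation V := (chebV R).

Definition subalgebra S : Prop :=
  [/\ forall c, S c%:P, forall p q, S p -> S q -> S (p + q) &
      forall p q, S p -> S q -> S (p * q)].

Lemma subalgebraZ S c p : subalgebra S -> S p -> S (c *: p).
Proof. by case=> SC _ SM Sp; rewrite -mul_polyC; apply: SM. Qed.

Lemma subalgebraB S p q : subalgebra S -> S p -> S q -> S (p - q).
Proof.
move=> Salg Sp Sq; have [_ SD _] := Salg.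
by rewrite -scaleN1r; apply: SD => //; apply: subalgebraZ.
Qed.

Lemma subalgebra_comp S p q : subalgebra S -> S q -> S (p \Po q).
Proof.
case=> SC SD SM Sq; elim/poly_ind: p => [|p c IH].
  by rewrite comp_poly0; apply: SC.
by rewrite comp_polyD comp_polyM comp_polyX comp_polyC; apply/SD/SC/SM.
Qed.

(** Multiplication by [X] preserves the span of the [T k], as [2 X T_(j+1) = T_(j+2) + T_j];
    starting from [T 0 = 1] this reaches every monomial. *)
Lemma chebT_span L : (forall p q, L p -> L q -> L (p + q)) ->
  (forall c p, L p -> L (c *: p)) -> (forall k, L (T k)) -> forall p, L p.
Proof.
move=> LD LZ LT; have LXT i j : L ('X^i * T j).
  elim: i j => [|i IH] [|j]; rewrite ?expr0 ?mul1r //.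
    by rewrite mulr1 exprSr; exact: (IH 1%N).
  have -> : 'X^(i.+1) * T j.+1 =
      (2%:R^-1 : R) *: ('X^i * T j.+2 + 'X^i * T j).
    rewrite -mulrDr chebTSS subrK exprSr -!mulrA.
    by rewrite mulr_natl mulrnAr -scaler_nat scalerA mulVf ?scale1r ?pnatr_eq0.
  by apply/LZ/LD; apply: IH.
move=> p; rewrite -[p]coefK poly_def; elim/big_ind: _ => //.
  by rewrite -(scale0r 1); apply: LZ; exact: (LT 0%N).
by move=> i _; apply: LZ; rewrite -[_ ^+ _]mulr1; exact: (LXT i 0%N).
Qed.

Lemma chebV_span L : (forall p q, L p -> L q -> L (p + q)) ->
  (forall c p, L p -> L (c *: p)) -> (forall k, L (V k)) -> forall p, L p.
Proof.
move=> LD LZ LV; apply: chebT_span => // -[|k]; first exact: (LV 1%N).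
have -> : T k.+1 = 2^-1 *: V k.+2 + - 2^-1 *: V k.
  apply: (@scalerI _ _ 2); first by rewrite pnatr_eq0.
  rewrite scalerDr !scalerA mulrN divff ?pnatr_eq0 // scale1r scaleN1r.
  rewrite scaler_nat chebVSS.
  by have [-> ->] := chebTVS R k; ring.
by apply: LD; apply: LZ; apply: LV.
Qed.

End Subalgebras.

(** * The node-swapping map [K], the polynomial [Q] and its derivative *)

Section TorusFolding.
Variables (R : realFieldType) (m n u v : nat).
Hypotheses (m_gt0 : (0 < m)%N) (lt_mn : (m < n)%N) (uv : (u * m = v * n + 1)%N).
Implicit Types (t w : R) (p q : {poly R}).

Local Notation T := (chebT R).
Local Notation V := (chebV R).

(* On t = cos(k pi / (mn)) this is k |-> k (um + vn), which is the identity
   modulo 2m and minus the identity modulo 2n: it swaps the two parameters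
   of each node. *)
Definition fold : {poly R} := T (u * m + v * n).
Local Notation K := fold.

Section Membership.
Variable S : {poly R} -> Prop.
Hypotheses (Salg : subalgebra S) (STm : S (T m)) (STn : S (T n)).

Lemma add_fold_mem p : S (p + (p \Po K)).
Proof.
have [_ SD SM] := Salg.
elim/chebT_span: p => [p q Sp Sq|c p Sp|j].
- by rewrite comp_polyD addrACA; apply: SD.
- by rewrite comp_polyZ -scalerDr; apply: subalgebraZ.
rewrite -chebT_mul mulnDr.
have le_ab : (j * (v * n) <= j * (u * m))%N by rewrite uv; nia.
(* [T_j] and [T_j o K] become the difference and the sum formula for the same two indices, so their
   [V] terms cancel. *)
have {1}-> : j = (j * (u * m) - j * (v * n))%N by rewrite uv; nia.
rewrite chebT_sub // chebT_add !mulnA.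
set a := T _; set b := T _; set z := (X in _ - X).
have -> : a * b - z + (a * b + z) = 2%:R *: (a * b) by rewrite scaler_nat; ring.
by apply: subalgebraZ => //; apply: SM;
  rewrite /a /b chebT_mul; apply: subalgebra_comp.
Qed.

(** Both [V] factors are [V c] times a polynomial in [T c], and
    [(X^2 - 1) (V c)^2 = (T c)^2 - 1]. *)
Lemma chebV_mul_mem c k l : S (T c) ->
  S (('X^2 - 1) * (V (k * c) * V (l * c))).
Proof.
move=> STc; have [SC SD SM] := Salg.
have -> : ('X^2 - 1) * (V (k * c) * V (l * c)) =
    (V k \Po T c) * (V l \Po T c) * (T c * T c - 1).
  by rewrite !chebV_mul -expr2 cheb_pell; ring.
have Scomp q : S (q \Po T c) by apply: subalgebra_comp.
by apply: (SM _ _ (SM _ _ _ _)) => //; apply: subalgebraB; auto; apply: (SC 1).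
Qed.

(** Expanding [V_j = V_(jum - jvn)] pairs [V (m * n)] with a [V] of a multiple of [m] or of [n]; the
    remaining factor is a polynomial in [T n] or [T m]. *)
Lemma conductor_mem p : S (('X^2 - 1) * V (m * n) * p).
Proof.
have [_ SD SM] := Salg.
elim/chebV_span: p => [p q Sp Sq|c p Sp|j]; first by rewrite mulrDr; apply: SD.
  by rewrite -scalerAr; apply: subalgebraZ.
have le_ab : (j * v * n <= j * u * m)%N by rewrite -!mulnA uv; nia.
have -> : j = (j * u * m - j * v * n)%N by rewrite -!mulnA uv; nia.
rewrite chebV_sub // mulrBr; apply: subalgebraB => //.
  rewrite mulrA; apply: SM; last by rewrite chebT_mul; apply: subalgebra_comp.
  by rewrite -mulrA [(m * n)%N]mulnC; apply: chebV_mul_mem.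
rewrite mulrCA; apply: SM; first by rewrite chebT_mul; apply: subalgebra_comp.
by rewrite -mulrA; apply: chebV_mul_mem.
Qed.

End Membership.

Lemma eval_eq_subalgebra t w : subalgebra (fun p => p.[t] = p.[w]).
Proof.
by split=> [c|p q|p q] *; rewrite !hornerE //; congr (_ _ _).
Qed.

Lemma double_point t w : (T m).[t] = (T m).[w] -> (T n).[t] = (T n).[w] ->
  t <> w -> w = K.[t] /\ (t ^+ 2 - 1) * (V (m * n)).[t] = 0.
Proof.
move=> tm tn tw; have Salg := eval_eq_subalgebra t w; split.
  (* [p + p o K] identifies [t] and [w]; this [p] vanishes at [t] and [K t]. *)
  pose p : {poly R} := (('X - t%:P) * ('X - K.[t]%:P)) ^+ 2.
  have := add_fold_mem Salg tm tn p.
  rewrite !hornerD !horner_comp /p !horner_exp !hornerM !hornerXsubC.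
  rewrite !subrr mul0r mulr0 expr0n /= addr0 => /esym/eqP.
  rewrite paddr_eq0 ?sqr_ge0 // => /andP[].
  rewrite sqrf_eq0 mulf_eq0 !subr_eq0 => /orP[/eqP wt|/eqP //].
  by case: tw.
(* Both [c] and [c X] take equal values at [t] and [w], so [c(t) (t - w) = 0]. *)
pose c := ('X^2 - 1) * V (m * n).
have c_tw : c.[t] = c.[w].
  by have := conductor_mem Salg tm tn 1; rewrite mulr1.
have : (c * 'X).[t] = (c * 'X).[w] := conductor_mem Salg tm tn 'X.
rewrite !(hornerM c) !hornerX -c_tw => /eqP.
rewrite -subr_eq0 -mulrBr mulf_eq0 subr_eq0 => /orP[/eqP|/eqP //].
by rewrite /c !hornerE.
Qed.

Lemma foldE1 : (u * m + v * n = 2 * n * v + 1)%N. Proof. by lia. Qed.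

Lemma foldE2 : (u * m + v * n = 2 * m * u - 1)%N. Proof. by lia. Qed.

(* At t = cos x this is - sin(m x) sin(n x). *)
Definition foldD : {poly R} := ('X^2 - 1) * (V m * V n).
Local Notation D := foldD.

(** At a root of [(t^2 - 1) V m] or [(t^2 - 1) V n] the index of [K] reduces to [1]: it is [-1]
    modulo [2m] and [1] modulo [2n]. *)
Lemma fold_id t : D.[t] = 0 -> K.[t] = t.
Proof.
rewrite /D mulrA => Dt.
have [/eqP|/eqP] : (t ^+ 2 - 1) * (V m).[t] == 0 \/ (t ^+ 2 - 1) * (V n).[t] == 0.
- move/eqP: Dt; rewrite !hornerE /= mulf_eq0 => /orP[->|/eqP->]; first by left.
  by right; rewrite mulr0.
- by move=> Vm; rewrite /K foldE2 (chebT_reflect Vm) ?hornerX //; nia.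
- by move=> Vn; rewrite /K foldE1 (chebT_period _ _ Vn) hornerX.
Qed.

Section AtRoot.
Variable t : R.
Hypothesis Wt : (t ^+ 2 - 1) * (V (m * n)).[t] = 0.

Lemma fold_chebT_m : (T m).[K.[t]] = (T m).[t].
Proof.
rewrite -horner_comp -chebT_mul.
have -> : (m * (u * m + v * n) = 2 * (m * n) * v + m)%N by rewrite foldE1; nia.
exact: chebT_period.
Qed.

Lemma fold_chebT_n : (T n).[K.[t]] = (T n).[t].
Proof.
rewrite -horner_comp -chebT_mul.
have -> : (n * (u * m + v * n) = 2 * (m * n) * u - n)%N by rewrite foldE2; nia.
by apply: chebT_reflect => //; nia.
Qed.

Lemma fold_chebT_mn : (T (m * n)).[K.[t]] = (T (m * n)).[t].
Proof. by rewrite chebT_mul !horner_comp fold_chebT_n. Qed.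

Lemma foldK : K.[K.[t]] = t.
Proof.
rewrite -horner_comp -chebT_mul.
(* [(2nv + 1)(2mu - 1) = 4mnuv + 2(um - vn) - 1], where [um - vn = 1]. *)
have -> : ((u * m + v * n) * (u * m + v * n) = 2 * (m * n) * (2 * u * v) + 1)%N.
  by rewrite {1}foldE1 foldE2; nia.
by rewrite (chebT_period _ _ Wt) hornerX.
Qed.

(** [2 D = T_(n+m) - T_(n-m)], and multiplication by [um + vn] exchanges [n + m] and [n - m] modulo
    [2mn], up to sign. *)
Lemma foldD_fold : D.[K.[t]] = - D.[t].
Proof.
have le_mn := ltnW lt_mn.
have D2 x : D.[x] + D.[x] = (T (n + m)).[x] - (T (n - m)).[x].
  by rewrite chebT_add chebT_sub // /D !hornerE /=; ring.
have lt_vu : (v < u)%N by nia.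
suff : D.[K.[t]] + D.[K.[t]] = - (D.[t] + D.[t]) by lra.
rewrite !D2 -!horner_comp -!chebT_mul opprB; congr (_ - _).
  have -> : ((n + m) * (u * m + v * n) = 2 * (m * n) * (u + v) - (n - m))%N.
    by rewrite mulnDl {1}foldE2 foldE1; nia.
  by apply: chebT_reflect => //; nia.
have -> : ((n - m) * (u * m + v * n) = 2 * (m * n) * (u - v) - (n + m))%N.
  by rewrite mulnBl {1}foldE2 foldE1; nia.
by apply: chebT_reflect => //; nia.
Qed.

Lemma fold_neq : D.[t] != 0 -> K.[t] != t.
Proof.
apply: contraNneq => Kt; have := foldD_fold; rewrite Kt => DN; apply/eqP; lra.
Qed.

End AtRoot.

(** The difference formula for [V_(um - vn) = V 1]. It yields a Bezout identity for [V m] and [V n],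
    which divide [V (u * m)] and [V (v * n)]. *)
Lemma cheb_bezout : V (u * m) * T (v * n) - T (u * m) * V (v * n) = 1.
Proof. by rewrite -chebV_sub ?uv ?addKn // leq_addr. Qed.

Lemma dvdp_chebV a b : V b %| V (a * b).
Proof. by rewrite chebV_mul dvdp_mulIr. Qed.

Lemma chebV_coprime : coprimep (V m) (V n).
Proof.
apply/Bezout_coprimepP.
exists ((V u \Po T m) * T (v * n), - T (u * m) * (V v \Po T n)).
suff -> : (V u \Po T m) * T (v * n) * V m + - T (u * m) * (V v \Po T n) * V n = 1.
  exact: eqpxx.
by rewrite -cheb_bezout !chebV_mul; ring.
Qed.

Definition chebQ : {poly R} := V (m * n) %/ (V m * V n).
Local Notation Q := chebQ.

Lemma chebQE : V (m * n) = Q * (V m * V n).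
Proof.
rewrite divpK // Gauss_dvdp ?chebV_coprime // dvdp_chebV andbT.
by rewrite mulnC dvdp_chebV.
Qed.

Lemma foldD_chebQ : ('X^2 - 1) * V (m * n) = Q * D.
Proof. by rewrite chebQE /D; ring. Qed.

Lemma chebQ_root t : Q.[t] = 0 -> (t ^+ 2 - 1) * (V (m * n)).[t] = 0.
Proof. by move=> Qt; rewrite chebQE hornerM Qt mul0r mulr0. Qed.

(* At a root of [Q], differentiating [V (mn) = Q V_m V_n] leaves one term. *)
Lemma chebQ_deriv t : Q.[t] = 0 ->
  D.[t] * Q^`().[t] = (m * n)%:R * (T (m * n)).[t].
Proof.
move=> Qt; have Vt : (V (m * n)).[t] = 0 by rewrite chebQE hornerM Qt mul0r.
have -> : D.[t] * Q^`().[t] = (('X^2 - 1) * (V (m * n))^`()).[t].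
  by rewrite /D chebQE derivM !hornerE /= Qt; ring.
rewrite chebV_deriv -(rmorph_nat (@polyC R)) hornerD hornerN !hornerM Vt.
by rewrite hornerC mulr0 subr0.
Qed.

Lemma chebQ_root_neq0 t : Q.[t] = 0 ->
  [/\ D.[t] != 0, Q^`().[t] != 0 & (T (m * n)).[t] ^+ 2 = 1].
Proof.
move=> Qt; have T1 : (T (m * n)).[t] ^+ 2 = 1.
  rewrite -horner_exp cheb_pell chebQE !hornerE /= Qt.
  by rewrite !(mul0r, mulr0) addr0.
have : D.[t] * Q^`().[t] != 0.
  rewrite chebQ_deriv // mulf_neq0 //.
    by rewrite pnatr_eq0 -lt0n muln_gt0 m_gt0 (ltn_trans m_gt0 lt_mn).
  by rewrite -sqrf_eq0 T1 oner_eq0.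
by rewrite mulf_eq0 negb_or => /andP[].
Qed.

(** The second parameter is [K t]. Conversely a double point is a root of [W = Q D], and not of [D],
    whose roots [K] fixes. *)
Lemma chebQ_rootP t : Q.[t] = 0 <->
  exists2 w, t <> w & (T m).[t] = (T m).[w] /\ (T n).[t] = (T n).[w].
Proof.
split=> [Qt|[w tw [tm tn]]].
  have Wt := chebQ_root Qt; have [Dt _ _] := chebQ_root_neq0 Qt.
  exists K.[t]; first by apply/nesym/eqP/fold_neq.
  by rewrite fold_chebT_m ?fold_chebT_n.
have [wK Wt] := double_point tm tn tw.
have /eqP : Q.[t] * D.[t] = 0.
  by rewrite -hornerM -foldD_chebQ !hornerE.
by rewrite mulf_eq0 => /orP[/eqP //|/eqP /fold_id Kt]; case: tw; rewrite wK.
Qed.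

(** In [D Q' = mn T (mn)], [K] negates [D] and preserves [T (mn)]. *)
Lemma chebQ_deriv_fold t : Q.[t] = 0 ->
  Q^`().[K.[t]] = - Q^`().[t].
Proof.
move=> Qt; have Wt := chebQ_root Qt; have [Dt _ _] := chebQ_root_neq0 Qt.
have QK : Q.[K.[t]] = 0.
  apply/chebQ_rootP; exists t; first exact/eqP/fold_neq.
  by rewrite fold_chebT_m ?fold_chebT_n.
apply: (mulfI Dt); rewrite mulrN chebQ_deriv // -fold_chebT_mn //.
by rewrite -chebQ_deriv // foldD_fold // mulNr opprK.
Qed.

(** Multiplication by [V_(um+vn)(t)] turns [V_m(K t)] into [V_m(t)] but [V_n(K t)] into [- V_n(t)].
    It turns the determinant into [-2 V_m(t) V_n(t)], nonzero because [D(t)] is. *)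
Lemma velocity_independent t : Q.[t] = 0 ->
  (V m).[t] * (V n).[K.[t]] - (V n).[t] * (V m).[K.[t]] != 0.
Proof.
move=> Qt; have Wt := chebQ_root Qt; have [Dt _ _] := chebQ_root_neq0 Qt.
have TVN b : (T (2 * (m * n) * b)).[t] = 1 /\ (V (2 * (m * n) * b)).[t] = 0.
  split; first exact: (chebT_double_root b Wt).1.
  rewrite mulnAC chebV_mul hornerM chebQE (hornerM Q) Qt; ring.
have Vm : (V m).[K.[t]] * (V (u * m + v * n)).[t] = (V m).[t].
  rewrite -horner_comp -hornerM -chebV_mul.
  have -> : (m * (u * m + v * n) = 2 * (m * n) * v + m)%N by rewrite foldE1; nia.
  by rewrite chebV_add hornerD !hornerM (TVN v).1 (TVN v).2; ring.
have Vn : (V n).[K.[t]] * (V (u * m + v * n)).[t] = - (V n).[t].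
  rewrite -horner_comp -hornerM -chebV_mul.
  have -> : (n * (u * m + v * n) = 2 * (m * n) * u - n)%N by rewrite foldE2; nia.
  by rewrite chebV_sub ?hornerD ?hornerN ?hornerM ?(TVN u).1 ?(TVN u).2; [ring | nia].
apply: contraNneq Dt => det0; rewrite /D hornerM [(V m * _).[t]]hornerM mulf_eq0.
apply/orP; right.
suff /eqP : 2%:R * ((V m).[t] * (V n).[t]) = 0 by rewrite mulf_eq0 pnatr_eq0.
transitivity (- ((V m).[t] * (V n).[K.[t]] - (V n).[t] * (V m).[K.[t]]) *
  (V (u * m + v * n)).[t]); last by rewrite det0 oppr0 mul0r.
by rewrite mulNr mulrBl -!mulrA Vm Vn; ring.
Qed.

(** The divisibility hypothesis expresses that [W] splits with simple roots; it reduces membership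
    in [S] to values at the roots of [W]. *)
Lemma subalgebra_full S : subalgebra S -> S (T m) -> S (T n) -> S Q^`() ->
  (forall f, (forall t, (t ^+ 2 - 1) * (V (m * n)).[t] = 0 -> f.[t] = 0) ->
     ('X^2 - 1) * V (m * n) %| f) ->
  forall p, S p.
Proof.
move=> Salg STm STn SQ' Wdvd p; have [SC SD SM] := Salg.
have S_vanish f : (forall t, (t ^+ 2 - 1) * (V (m * n)).[t] = 0 -> f.[t] = 0) -> S f.
  by move=> /Wdvd /dvdpP[r ->]; rewrite mulrC; apply: conductor_mem.
pose d := p - (p \Po K); pose g := d * D * T (m * n).
have d_fold t : (t ^+ 2 - 1) * (V (m * n)).[t] = 0 -> d.[K.[t]] = - d.[t].
  by move=> Wt; rewrite !hornerE !horner_comp foldK // opprB.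
(* [K] negates [d] and [D] and preserves [T (m * n)] at the roots of [W], so there [g] equals
   [g o K]. *)
have Sg : S g.
  have -> : g = 2^-1 *: ((g + (g \Po K)) - ((g \Po K) - g)).
    rewrite opprB addrACA subrr addr0 -mulr2n.
    by rewrite -scaler_nat scalerA mulVf ?scale1r ?pnatr_eq0.
  apply: subalgebraZ => //; apply: subalgebraB => //; first exact: add_fold_mem.
  apply: S_vanish => t Wt; rewrite hornerD hornerN horner_comp.
  rewrite !(hornerM (d * D)) !(hornerM d).
  by rewrite d_fold // foldD_fold // fold_chebT_mn //; ring.
(* [g Q' / (mn)] agrees with the antisymmetric part [d] on the roots of
   [(X^2 - 1) V (mn)]: at the roots of [Q] because [D Q' = mn T (mn)] and
   [T (mn) ^ 2 = 1] there, at the others because [K] fixes them. *)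
have Sd : S d.
  have mn_neq0 : (m * n)%:R != 0 :> R by rewrite pnatr_eq0; nia.
  rewrite -[d](subrK ((m * n)%:R^-1 *: (g * Q^`()))); apply: SD; last first.
    by apply: subalgebraZ => //; apply: SM.
  apply: S_vanish => t Wt; rewrite hornerD hornerN hornerZ.
  rewrite (hornerM g) (hornerM (d * D)) (hornerM d).
  have /eqP : Q.[t] * D.[t] = 0 by rewrite -hornerM -foldD_chebQ !hornerE.
  rewrite mulf_eq0 => /orP[/eqP Qt|/eqP Dt].
    have [_ _ T1] := chebQ_root_neq0 Qt.
    transitivity (d.[t] *
        (1 - (m * n)%:R^-1 * (D.[t] * Q^`().[t] * (T (m * n)).[t])));
      first by ring.
    by rewrite chebQ_deriv // -[_ * _ * _]mulrA -expr2 T1 mulr1 mulVf ?subrr ?mulr0.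
  have -> : d.[t] = 0 by rewrite hornerD hornerN horner_comp fold_id // subrr.
  by rewrite !mul0r mulr0 subrr.
have -> : p = 2^-1 *: ((p + (p \Po K)) + d).
  rewrite /d addrACA subrr addr0 -mulr2n.
  by rewrite -scaler_nat scalerA mulVf ?scale1r ?pnatr_eq0.
by apply: subalgebraZ => //; apply: (SD _ _ _ Sd); apply: add_fold_mem.
Qed.

End TorusFolding.

(** * Degrees, leading coefficients and signs of derivatives at simple roots *)

Section SizeAndSign.
Variable R : realFieldType.

Lemma chebV_size_lead n :
  [/\ size (chebV R n) = n, size (chebV R n.+1) = n.+1 &
   0 < lead_coef (chebV R n.+1)].
Proof.
elim: n => [|n [sz0 sz1 lc]].
  by rewrite size_poly0 size_poly1 lead_coef1 ltr01.
pose p : {poly R} := 2%:R *: (chebV R n.+1 * 'X).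
have sz_p : size p = n.+2.
  by rewrite size_scale ?pnatr_eq0 // size_mulX ?sz1 // -size_poly_gt0 sz1.
have lt_p : (size (- chebV R n) < size p)%N by rewrite size_polyN sz_p sz0.
have -> : chebV R n.+2 = p - chebV R n.
  by rewrite chebVSS /p -mul_polyC rmorph_nat; ring.
by rewrite size_polyDl // lead_coefDl // lead_coefZ lead_coefMX mulr_gt0 ?ltr0n.
Qed.

Lemma size_chebV n : size (chebV R n) = n.
Proof. by case: (chebV_size_lead n). Qed.

Lemma lead_coef_chebV_gt0 n : (0 < n)%N -> 0 < lead_coef (chebV R n).
Proof. by case: n => // n _; case: (chebV_size_lead n). Qed.

(** The derivative at a root is the product of its differences with the other roots, and the
    negative factors come from the larger roots. *)
Lemma sgr_deriv_prod_XsubC (s : seq R) i : sorted <%R s -> (i < size s)%N ->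
  Num.sg (\prod_(x <- s) ('X - x%:P))^`().[s`_i] = (-1) ^+ (size s - i.+1).
Proof.
elim: s i => [|x s IH] i //= lt_s; rewrite big_cons derivM derivXsubC mul1r.
have x_lt : all (> x) s by apply: order_path_min lt_s; apply: lt_trans.
rewrite hornerD hornerM hornerXsubC.
case: i => [_|i] /=.
  rewrite subrr mul0r addr0 subn1 /= horner_prod.
  rewrite (eq_big_seq (fun z => x - z)); last by move=> z _; rewrite hornerXsubC.
  elim: (s) x_lt => [|z r IHr] /=; first by rewrite big_nil sgr1.
  by move=> /andP[xz /IHr {}IHr]; rewrite big_cons sgrM IHr ltr0_sg ?subr_lt0 // exprS.
rewrite ltnS => lt_i; have si : s`_i \in s by apply: mem_nth.
have -> : (\prod_(z <- s) ('X - z%:P)).[s`_i] = 0.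
  by apply/eqP; rewrite -/(root _ _) root_prod_XsubC.
by rewrite add0r sgrM gtr0_sg ?subr_gt0 ?(allP x_lt) // mul1r IH ?subSS
  ?(path_sorted lt_s).
Qed.

End SizeAndSign.

(** * The real roots of [V n] *)

Section RealRoots.
Variable R : realType.
Implicit Types (t x : R).

Lemma chebTV_cos n x :
  (chebT R n).[cos x] = cos (n%:R * x) /\
  (chebV R n).[cos x] * sin x = sin (n%:R * x).
Proof.
elim: n => [|n [IHT IHV]]; first by rewrite mul0r cos0 sin0 /= hornerC horner0 mul0r.
have [-> ->] := chebTVS R n; rewrite -[n.+1%:R]natr1 [(_ + 1) * x]mulrDl mul1r
  cosD sinD -IHT -IHV.
rewrite !hornerE /=; split; last by ring.
have s2 : sin x ^+ 2 = 1 - cos x ^+ 2 by have := cos2Dsin2 x; lra.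
by ring: s2.
Qed.

(** Zeros of [sin (n x) / sin x], taken with decreasing angles since [cos] decreases on
    [[0, pi]]. *)
Definition chebV_roots n : seq R :=
  [seq cos ((n - k)%:R / n%:R * pi) | k <- iota 1 n.-1].

Lemma chebV_roots_sorted n : sorted <%R (chebV_roots n).
Proof.
rewrite /chebV_roots sorted_map.
apply: (@sub_in_sorted _ (mem (iota 1 n.-1)) ltn); last exact: iota_ltn_sorted.
  move=> i j; rewrite ![_ \in mem _]mem_iota => Hi Hj ij /=.
  have n_gt0 : (0 : R) < n%:R by rewrite ltr0n; lia.
  have in_pi k : (k <= n)%N -> k%:R / n%:R * pi \in `[0 : R, pi].
    move=> le_kn; rewrite in_itv /= !mulr_ge0 ?invr_ge0 ?pi_ge0 //=.
    by rewrite ler_piMl ?pi_ge0 // ler_pdivrMr // mul1r ler_nat.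
  rewrite ltr_cos ?in_pi ?leq_subr // ltr_pM2r ?pi_gt0 // ltr_pM2r ?invr_gt0 //.
  by rewrite ltr_nat; lia.
exact/allP.
Qed.

Lemma chebV_prod_XsubC n :
  chebV R n = lead_coef (chebV R n) *: \prod_(x <- chebV_roots n) ('X - x%:P).
Proof.
case: n => [|n]; first by rewrite /= lead_coef0 scale0r.
apply: all_roots_prod_XsubC.
- by rewrite size_chebV size_map size_iota.
- apply/allP => y /mapP[k]; rewrite mem_iota => Hk -> {y}; apply/rootP.
  pose x : R := (n.+1 - k)%:R / n.+1%:R * pi; rewrite -/x.
  have n_gt0 : 0 < n.+1%:R :> R by rewrite ltr0n.
  have x_gt0 : 0 < x by rewrite !mulr_gt0 ?pi_gt0 ?invr_gt0 // ltr0n; lia.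
  have x_lt : x < pi.
    by rewrite gtr_pMl ?pi_gt0 // ltr_pdivrMr // mul1r ltr_nat; lia.
  have s_gt0 : 0 < sin x by rewrite sin_gt0_pi // x_gt0.
  apply: (mulIf (lt0r_neq0 s_gt0)); rewrite (chebTV_cos _ _).2 mul0r.
  rewrite /x mulrA mulrCA divff ?lt0r_neq0 // mulr1.
  elim: (_ - _)%N => [|j IH]; first by rewrite mul0r sin0.
  by rewrite -natr1 mulrDl mul1r sinDpi IH oppr0.
by rewrite uniq_rootsE; apply: lt_sorted_uniq; apply: chebV_roots_sorted.
Qed.

(** At [t^2 = 1] the differential relation reads [n T n = t V n], so a zero of [V n] would be one of
    [T n], against [(T n)^2 = 1]. *)
Lemma chebV_neq0_at_pm1 n t : (0 < n)%N -> t ^+ 2 = 1 -> (chebV R n).[t] != 0.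
Proof.
move=> n_gt0 t2; apply/eqP => Vt.
have T2 : (chebT R n).[t] ^+ 2 = 1.
  by rewrite -horner_exp cheb_pell hornerD hornerM horner_exp Vt expr0n
    mulr0 hornerC addr0.
have /eqP := congr1 (horner^~ t) (chebV_deriv R n).
rewrite -(rmorph_nat (@polyC R)) hornerD hornerN !hornerM Vt hornerC !hornerE /=.
rewrite t2 subrr mul0r subr0 eq_sym mulf_eq0 pnatr_eq0 => /orP[|/eqP Tt]; first by lia.
by move/eqP: T2; rewrite Tt expr0n eq_sym oner_eq0.
Qed.

(** The roots [1] and [-1] of the first factor are new, so the product still splits with simple
    roots. *)
Lemma chebV_boundary_dvdp n f : (0 < n)%N ->
  (forall t, (t ^+ 2 - 1) * (chebV R n).[t] = 0 -> f.[t] = 0) ->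
  ('X^2 - 1) * chebV R n %| f.
Proof.
move=> n_gt0 f0; pose r := [:: 1, -1 & chebV_roots n].
have Wr : ('X^2 - 1) * chebV R n =
    lead_coef (chebV R n) *: \prod_(x <- r) ('X - x%:P).
  rewrite {1}chebV_prod_XsubC !big_cons mulrA -scalerAr rmorphN1 opprK.
  by congr (_ *: (_ * _)); ring.
have r_root x : x \in r -> (x ^+ 2 - 1) * (chebV R n).[x] = 0.
  move=> xr; transitivity (('X^2 - 1) * chebV R n).[x]; first by rewrite !hornerE.
  rewrite Wr hornerZ; suff /eqP-> : root (\prod_(y <- r) ('X - y%:P)) x.
    by rewrite mulr0.
  by rewrite root_prod_XsubC.
rewrite Wr dvdpZl ?lt0r_neq0 ?lead_coef_chebV_gt0 //.
apply: uniq_roots_dvdp.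
  by apply/allP => x /r_root /f0 /rootP.
have not_root x : x ^+ 2 = 1 -> x \notin chebV_roots n.
  move=> x2; apply: contra (chebV_neq0_at_pm1 n_gt0 x2) => xr.
  rewrite chebV_prod_XsubC hornerZ mulf_eq0; apply/orP; right.
  by rewrite -/(root _ _) root_prod_XsubC.
rewrite uniq_rootsE /= inE negb_or !not_root ?sqrrN ?expr1n //.
rewrite lt_sorted_uniq ?chebV_roots_sorted // !andbT.
by rewrite -subr_eq0 opprK -mulr2n pnatr_eq0.
Qed.

End RealRoots.

(** * Nodes, embedding and crossing signs *)

Import numFieldNormedType.Exports.
Import (canonicals) mpoly.

Lemma row_free_col_mx2 (F : fieldType) (x y : 'rV[F]_2) :
  x 0 0 * y 0 1 - x 0 1 * y 0 0 != 0 -> row_free (col_mx x y).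
Proof.
move=> det_neq0; apply: inj_row_free => w.
rewrite -[w]hsubmxK mul_row_col.
move: (lsubmx w) (rsubmx w) => a b /matrixP eq0.
have := eq0 0 0; have := eq0 0 1; rewrite !mxE !big_ord1 => eq1 eq2.
(* Cramer's rule for the relation [a x + b y = 0]. *)
have a0 : a 0 0 = 0.
  apply: (mulIf det_neq0).
  transitivity ((a 0 0 * x 0 0 + b 0 0 * y 0 0) * y 0 1 -
    (a 0 0 * x 0 1 + b 0 0 * y 0 1) * y 0 0); first by ring.
  by rewrite eq1 eq2; ring.
have b0 : b 0 0 = 0.
  apply: (mulIf det_neq0).
  transitivity ((a 0 0 * x 0 1 + b 0 0 * y 0 1) * x 0 0 -
    (a 0 0 * x 0 0 + b 0 0 * y 0 0) * x 0 1); first by ring.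
  by rewrite eq1 eq2; ring.
by rewrite [a]mx11_scalar [b]mx11_scalar a0 b0 !raddf0 row_mx0.
Qed.

Section KnotDiagram.
Variables (R : realType) (m n u v : nat).
Hypotheses (m_gt0 : (0 < m)%N) (lt_mn : (m < n)%N) (uv : (u * m = v * n + 1)%N).
Implicit Types (t w : R).

Local Notation T := (chebT R).
Local Notation V := (chebV R).
Local Notation Q := (chebQ R m n).
Local Notation alpha := [tuple T m; T n].

Lemma polymap_pairP (f g : {poly R}) t w :
  polymap [tuple f; g] t = polymap [tuple f; g] w <->
  f.[t] = f.[w] /\ g.[t] = g.[w].
Proof.
split=> [/rowP eqP|[eqf eqg]].
  by have := eqP 0; have := eqP 1; rewrite !mxE.
by apply/rowP => -[[|[|//]] ?]; rewrite !mxE.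
Qed.

Lemma velocity_alpha t :
  velocity alpha t 0 0 = m%:R * (V m).[t] /\
  velocity alpha t 0 1 = n%:R * (V n).[t].
Proof.
by rewrite !mxE /= !chebT_deriv -!(rmorph_nat (@polyC R)) !hornerM !hornerC.
Qed.

Lemma nodal_alpha : nodal alpha /\
  polymap alpha @^-1` nodes alpha = [set t | Q.[t] = 0].
Proof.
have [m_neq0 n_neq0] : m%:R != 0 :> R /\ n%:R != 0 :> R.
  by rewrite !pnatr_eq0; lia.
have node_at t : Q.[t] = 0 -> nodes alpha (polymap alpha t).
  move=> Qt; have Wt := chebQ_root uv Qt.
  have [Dt _ _] := chebQ_root_neq0 m_gt0 lt_mn uv Qt.
  exists t, (fold R m n u v).[t]; split.
  - by apply/nesym/eqP/(fold_neq m_gt0 lt_mn uv).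
  - apply/seteqP; split=> w /=; last first.
      move=> [->//|->]; apply/polymap_pairP.
      by rewrite (fold_chebT_m m_gt0 lt_mn uv) ?(fold_chebT_n m_gt0 lt_mn uv).
    have [->|/eqP wt] := eqVneq w t; first by left.
    move=> /esym /polymap_pairP[tm tn]; right.
    exact: (double_point m_gt0 lt_mn uv tm tn (nesym wt)).1.
  - apply: row_free_col_mx2; rewrite !(velocity_alpha _).1 !(velocity_alpha _).2.
    have := velocity_independent m_gt0 lt_mn uv Qt.
    apply: contraNneq => det0; apply/eqP.
    apply: (mulfI (mulf_neq0 m_neq0 n_neq0)); rewrite mulr0 -det0; ring.
have root_at t w : t <> w -> polymap alpha t = polymap alpha w -> Q.[t] = 0.
  by move=> tw /polymap_pairP tw_eq; apply/(chebQ_rootP m_gt0 lt_mn uv); exists w.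
split; [split|].
- move=> t /rowP vt; have := vt 0; have := vt 1.
  rewrite (velocity_alpha t).1 (velocity_alpha t).2 !mxE => /eqP.
  rewrite mulf_eq0 (negbTE n_neq0) => /= /eqP Vn /eqP.
  rewrite mulf_eq0 (negbTE m_neq0) => /= /eqP Vm.
  (* A zero velocity makes [V m] and [V n] vanish together, against the Bezout identity. *)
  have := congr1 (horner^~ t) (cheb_bezout R uv).
  rewrite !chebV_mul !hornerE /= Vn Vm !(mulr0, mul0r) subrr => /eqP.
  by rewrite eq_sym oner_eq0.
- move=> P [t [w [tw <- /esym tw_eq]]]; apply: node_at; exact: root_at tw tw_eq.
apply/seteqP; split=> t /=; last exact: node_at.
move=> [a [b [ab pre _]]].
have eqv x : [set a; b] x -> polymap alpha x = polymap alpha t.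
  by rewrite -pre.
have [ta|/eqP ta] := eqVneq t a.
  by apply: (root_at t b); [rewrite ta | rewrite eqv //; right].
by apply: (root_at t a) => //; rewrite eqv //; left.
Qed.

(** [Q] divides [V (m * n)] and inherits its simple real roots; the count is
    [(mn - 1) - (m - 1) - (n - 1)]. *)
Lemma chebQ_prod_XsubC : exists s : seq R,
  [/\ sorted <%R s, Q = lead_coef Q *: \prod_(x <- s) ('X - x%:P),
      0 < lead_coef Q & size s = ((m - 1) * (n - 1))%N].
Proof.
have QE := chebQE R uv; have n_gt0 : (0 < n)%N by lia.
have mn_gt0 : (0 < m * n)%N by rewrite muln_gt0 m_gt0.
have lead_gt0 k : (0 < k)%N -> 0 < lead_coef (V k) by apply: lead_coef_chebV_gt0.
have lcQ : 0 < lead_coef Q.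
  have := congr1 lead_coef QE; rewrite !lead_coefM => lcE.
  have VV_gt0 : 0 < lead_coef (V m) * lead_coef (V n) by rewrite mulr_gt0 ?lead_gt0.
  by rewrite -(pmulr_lgt0 _ VV_gt0) -lcE lead_gt0.
have nz p : 0 < lead_coef p -> p != 0 :> {poly R}.
  by move=> lc; rewrite -lead_coef_eq0 lt0r_neq0.
have : Q %| \prod_(x <- chebV_roots R (m * n)) ('X - x%:P).
  have := dvdp_mulr (V m * V n) (dvdpp Q); rewrite -QE.
  by rewrite [V (m * n)]chebV_prod_XsubC dvdpZr ?lt0r_neq0 ?lead_gt0.
move=> /(@dvdp_prod_XsubC _ _ _ id)[mk]; set s := mask _ _ => Qs.
have Q_E : Q = lead_coef Q *: \prod_(x <- s) ('X - x%:P).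
  by have := eqp_eq Qs; rewrite (monicP (monic_prod_XsubC _ _ _)) scale1r.
exists s; split=> //.
  by apply: (subseq_sorted lt_trans (mask_subseq _ _)); apply: chebV_roots_sorted.
have := congr1 (fun p : {poly R} => size p) QE.
rewrite size_chebV size_mul ?mulf_neq0 ?nz ?lead_gt0 //.
rewrite size_mul ?nz ?lead_gt0 ?size_chebV //.
rewrite Q_E size_scale ?lt0r_neq0 // size_prod_XsubC.
by rewrite -(prednK m_gt0) -(prednK n_gt0) !subn1 mulSn mulnS !(addSn, addnS) /=; lia.
Qed.

Lemma is_embedding_chebQ : is_embedding [tuple T m; T n; Q^`()].
Proof.
set f := [tuple _; _; _]; move=> p.
pose S q := exists P : mpoly.mpoly 3 R, mpoly.mmap (@polyC R) (tnth f) P = q.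
have Sf i : S (tnth f i).
  exists (mpoly.mpolyX R (mpoly.mnm1 i)).
  by rewrite mpoly.mmapX mpoly.mmap1U.
apply: (@subalgebra_full R m n u v m_gt0 lt_mn uv S).
- split.
  + by move=> c; exists (mpoly.mpolyC 3 c); rewrite mpoly.mmapC.
  + by move=> q r [P <-] [P' <-]; exists (P + P'); rewrite rmorphD.
  + by move=> q r [P <-] [P' <-]; exists (P * P'); rewrite rmorphM.
- exact: (Sf 0).
- exact: (Sf 1).
- exact: (Sf 2%:R).
- by move=> g; apply: chebV_boundary_dvdp; rewrite muln_gt0 m_gt0; lia.
Qed.

Lemma is_alternating_knot_chebQ :
  is_alternating_knot m n (range (polymap [tuple T m; T n; Q^`()])).
Proof.
have [s [s_sorted QE lcQ s_size]] := chebQ_prod_XsubC.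
have [nod preim] := nodal_alpha.
have rootQ x : (Q.[x] = 0) <-> x \in s.
  rewrite QE hornerZ -root_prod_XsubC; split=> [/eqP|/rootP->]; last by rewrite mulr0.
  by rewrite mulf_eq0 (gt_eqF lcQ).
(* Evenness fixes the global sign: [(-1)^(size s - (i+1))] becomes [(-1)^(i+1)], exactly the
   alternating sequence. *)
have even_s : ~~ odd (size s).
  have mn_odd : odd m || odd n.
    apply: contraT; rewrite negb_or => /andP[me ne].
    have : odd (u * m) = odd (v * n + 1) by rewrite uv.
    by rewrite oddD !oddM (negbTE me) (negbTE ne) !andbF.
  by rewrite s_size oddM !oddB ?m_gt0 //; [case/orP: mn_odd => ->; rewrite ?andbF | lia].
have sg_s i : (i < size s)%N -> Num.sg Q^`().[s`_i] = (-1) ^+ i.+1.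
  move=> lt_i; rewrite QE derivZ hornerZ sgrM gtr0_sg // mul1r.
  rewrite sgr_deriv_prod_XsubC // -signr_odd oddB // (negbTE even_s).
  by rewrite signr_odd.
have alt_nth i : (i < size s)%N -> (Defs.alternating (size s))`_i = (-1) ^+ i.+1.
  by move=> lt_i; rewrite nth_mkseq.
exists s; split=> //.
- split=> //; rewrite preim; apply/seteqP; split=> x /=; first by move/rootQ.
  by move/rootQ.
- split; first by rewrite size_mkseq.
    move=> _ /mapP[i _ ->]; rewrite !inE -signr_odd.
    by case: (odd _); rewrite ?expr1 ?expr0 eqxx ?orbT.
  move=> p q lt_p lt_q pq /polymap_pairP[tm tn].
  have spq : s`_p <> s`_q.
    by move/eqP; rewrite nth_uniq ?lt_sorted_uniq // => /eqP.
  (* [Q'] has opposite signs at the two parameters of a node, so [p] and [q] have opposite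
     parity. *)
  have [sq _] := double_point m_gt0 lt_mn uv tm tn spq.
  have Qp : Q.[s`_p] = 0 by apply/rootQ/mem_nth.
  have Q'q := chebQ_deriv_fold m_gt0 lt_mn uv Qp.
  have := sg_s q lt_q; rewrite sq Q'q sgrN sg_s // !alt_nth //.
  rewrite -[LHS]mulN1r -exprS -signr_odd -[RHS]signr_odd => sgE.
  rewrite -exprD -signr_odd oddD.
  move: sgE; rewrite /=; case: (odd p); case: (odd q) => //=;
    rewrite ?expr0 ?expr1 // => /eqP; last rewrite eq_sym.
  + by rewrite eq_sym -subr_eq0 opprK -mulr2n pnatr_eq0.
  + by rewrite eq_sym -subr_eq0 opprK -mulr2n pnatr_eq0.
have tupE : [tuple of rcons [tuple T m; T n] Q^`()] = [tuple T m; T n; Q^`()].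
  exact: val_inj.
(* The height is the third coordinate itself, so the identity serves as the equivalence. *)
exists Q^`(); last first.
  rewrite tupE; exists id, id; split=> //; first by move=> x; apply: cvg_id.
    by move=> x; apply: cvg_id.
  by rewrite image_id.
split; first by rewrite tupE; apply: is_embedding_chebQ.
(* Crossing signs are the signs of the height: positive over, negative under. *)
move=> p q lt_p lt_q _; rewrite !alt_nth // => ap aq.
have : Num.sg Q^`().[s`_p] = 1.
  rewrite sg_s //.
  by have := congr1 (fun z : int => z%:~R : R) ap; rewrite rmorph_sign.
have : Num.sg Q^`().[s`_q] = -1.
  rewrite sg_s //.
  by have := congr1 (fun z : int => z%:~R : R) aq; rewrite rmorph_sign.
move=> /eqP; rewrite sgr_cp0 => lt0 /eqP; rewrite sgr_cp0; exact: lt_trans.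
Qed.

End KnotDiagram.

Theorem proposition5p2 (R : realType) (m n : nat)
    (hco : coprime m n) (hm : (3 <= m)%N) (hmn : (m < n)%N) :
  let phi : 3.-tuple {poly R} :=
    [tuple chebT R m; chebT R n;
       (chebU R (m * n - 1) %/ (chebU R (m - 1) * chebU R (n - 1)))^`()] in
  is_embedding phi /\ is_alternating_knot m n (range (polymap phi)).
Proof.
have m_gt0 : (0 < m)%N by apply: leq_trans hm.
have [u v uv _] := egcdnP n m_gt0; rewrite (eqP hco) in uv.
have VE k : (0 < k)%N -> chebU R (k - 1) = chebV R k.
  by case: k => // k; rewrite subn1.
rewrite !VE ?muln_gt0 ?m_gt0 ?(ltn_trans m_gt0 hmn) // => phi; split.
  exact: @is_embedding_chebQ R m n u v m_gt0 hmn uv.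
exact: @is_alternating_knot_chebQ R m n u v m_gt0 hmn uv.
Qed.
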